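(* Let $r\geq 2$ be an integer, $N\in\mathbf{N}$, and let $G_N^{(r)}(q)\in\mathbf{N}[q]$ be the generalized Galois number. Let $\mathfrak{S}_N$ be the symmetric group on $N$ elements. Then $$G_N^{(r)}(q)=\sum_{\pi\in\mathfrak{S}_N}\binom{N+r-1-\operatorname{des}(\pi)}{N}\,q^{\operatorname{inv}(\pi)}.$$ For fixed $N$ and $r\to\infty$ we have $$\frac{N!}{r^N}\cdot G_N^{(r)}(q)\;\to\;\sum_{\pi\in\mathfrak{S}_N}q^{\operatorname{inv}(\pi)}=[N]_q!,$$ where convergence of polynomials in $q$ (of bounded degree) is coefficientwise.
   Context: $\mathbf{N}=\{0,1,2,\dots\}$. For a variable $q$, $[k]_q! = \prod_{i=1}^k \frac{1-q^i}{1-q}$. For $N\in\mathbf{N}$ and $\mathbf{k}=(k_1,\dots,k_r)\in\mathbf{N}^r$ the $q$-multinomial coefficient is $\left[{N \atop \mathbf{k}}\right]_q = \frac{[N]_q!}{[k_1]_q!\cdots[k_r]_q!}$ if $k_1+\cdots+k_r=N$, and $0$ otherwise. The generalized Galois number is $G_N^{(r)}(q)=\sum_{\mathbf{k}\in\mathbf{N}^r}\left[{N\atop\mathbf{k}}\right]_q$; for $q$ a prime power it equals the number of flags $0=V_0\subseteq\cdots\subseteq V_r=\mathbf{F}_q^N$ of length $r$, repetitions allowed. For $\pi\in\mathfrak{S}_N$: $D(\pi)=\{i:\pi(i)>\pi(i+1)\}$ is the descent set, $\operatorname{des}(\pi)=|D(\pi)|$, and $\operatorname{inv}(\pi)=|\{(i,j):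 i<j,\ \pi(i)>\pi(j)\}|$. Convention: $\binom{a}{b}=0$ unless $0\leq b\leq a$. *)

(* Defs.v *)
From HB Require Import structures.
From mathcomp Require Import all_boot all_order all_algebra all_fingroup.
From mathcomp Require Import all_classical all_reals all_analysis.
From mathcomp Require Import ring.
Set Implicit Arguments.
Unset Strict Implicit.
Unset Printing Implicit Defensive.
Import Order.TTheory GRing.Theory Num.Theory.
Import numFieldNormedType.Exports.
Local Open Scope classical_set_scope.
Local Open Scope ring_scope.

Section QAnalogues.
Variable F : fieldType.

(* The variable q is 'X. The operator %/ is Euclidean division in F[q]; every
   division below is exact over the reals, see subr1Xn, qfactE and qmultinomialK. *)
Definition qfact (k : nat) : {poly F} :=
  \prod_(1 <= i < k.+1) ((1 - 'X^i) %/ (1 - 'X)).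

Definition qmultinomial (N : nat) (k : seq nat) : {poly F} :=
  if sumn k == N then qfact N %/ \prod_(j <- k) qfact j else 0.

(* The sum over N^r is the finitely supported sum of fsbigop, which is 0 by
   convention on infinite supports; see finite_qmultinomial. *)
Definition galois_number (r N : nat) : {poly F} :=
  \sum_(k \in [set: r.-tuple nat]) qmultinomial N k.

End QAnalogues.

Section PermutationStatistics.
Variables (N : nat) (s : 'S_N).

Definition descent_set : {set 'I_N} :=
  [set i : 'I_N | [exists j : 'I_N, (j == i.+1 :> nat) && (s j < s i)%N]]%SET.

Definition des : nat := #|descent_set|.

Definition inversions : nat :=
  #|[set p : 'I_N * 'I_N | (p.1 < p.2)%N && (s p.2 < s p.1)%N]%SET|.

End PermutationStatistics.

Section Exactness.
Variable F : archiRealFieldType.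
Local Notation qnum n := (\sum_(i < n) 'X^i : {poly F}).

Lemma subr1X_neq0 : 1 - 'X != 0 :> {poly F}.
Proof. by rewrite -opprB oppr_eq0 polyXsubC_eq0. Qed.

Lemma subr1Xn n : 1 - 'X^n = qnum n * (1 - 'X).
Proof. by rewrite -opprB subrX1 -[1 - 'X]opprB mulrN mulrC. Qed.

Lemma qfactE n : (1 - 'X) ^+ n * qfact F n = \prod_(1 <= i < n.+1) (1 - 'X^i).
Proof.
elim: n => [|n IHn]; first by rewrite /qfact !big_nil mulr1.
rewrite /qfact big_nat_recr //= [RHS]big_nat_recr //= -IHn exprSr.
by rewrite subr1Xn mulpK ?subr1X_neq0// mulrACA [_ * qnum _]mulrC.
Qed.

Lemma qfact0 : qfact F 0 = 1.
Proof. by rewrite /qfact big_nil. Qed.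

Lemma qfactS n : qfact F n.+1 = qfact F n * qnum n.+1.
Proof. by rewrite /qfact big_nat_recr //= subr1Xn mulpK ?subr1X_neq0. Qed.

Lemma qfact_neq0 n : qfact F n != 0.
Proof.
suff: (qfact F n).[1] != 0 by apply: contraNneq => ->; rewrite horner0.
elim: n => [|n IHn]; first by rewrite /qfact big_nil hornerE oner_neq0.
rewrite qfactS hornerM mulf_neq0// horner_sum.
under eq_bigr do rewrite hornerXn expr1n.
by rewrite sumr_const card_ord pnatr_eq0.
Qed.

(* Num.nat unfolds to Num.nat_num_subdef, and only the latter carries the
   closedness instances used by the rpred lemmas. *)
Lemma qfactD a b : exists2 c : {poly F}, c \is a polyOver Num.nat_num_subdef &
  qfact F (a + b) = c * (qfact F a * qfact F b).
Proof.
have [n leabn] : exists n, (a + b <= n)%N by exists (a + b)%N.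
elim: n a b leabn => [|n IHn] [|a] [|b] leabn;
  try by exists 1; rewrite ?rpred1// ?addn0 qfact0 ?mul1r ?mulr1.
have [|c1 c1N e1] := IHn a b.+1; first by rewrite addSn in leabn.
have [|c2 c2N e2] := IHn a.+1 b; first by rewrite addnS in leabn.
exists (c1 + 'X^(a.+1) * c2).
  by rewrite rpredD// rpredM// polyOverXn.
rewrite addSn qfactS -addSn.
have -> : qnum (a.+1 + b.+1) = qnum a.+1 + 'X^(a.+1) * qnum b.+1.
  rewrite big_split_ord/=; congr (_ + _); rewrite mulr_sumr.
  by apply: eq_bigr => i _; rewrite exprD.
rewrite mulrDr {1}e1 addnS -addSn e2 !qfactS.
by move: (qnum _) (qnum _) (qfact F a) (qfact F b) => x y z t; ring.
Qed.

Lemma qfact_sumn (k : seq nat) : exists2 c : {poly F},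
  c \is a polyOver Num.nat_num_subdef & qfact F (sumn k) = c * \prod_(j <- k) qfact F j.
Proof.
elim: k => [|a k [c cN IHk]].
  by exists 1; rewrite ?rpred1//= qfact0 big_nil mul1r.
have [d dN e] := qfactD a (sumn k).
by exists (d * c); rewrite ?rpredM//= e IHk big_cons -!mulrA; congr (_ * _); rewrite mulrCA.
Qed.

Lemma prod_qfact_neq0 (k : seq nat) : \prod_(j <- k) qfact F j != 0.
Proof. by rewrite prodf_seq_neq0; apply/allP => j _; rewrite /= qfact_neq0. Qed.

Lemma qmultinomialK (k : seq nat) :
  qmultinomial F (sumn k) k * \prod_(j <- k) qfact F j = qfact F (sumn k).
Proof.
have [c _ e] := qfact_sumn k.
by rewrite /qmultinomial eqxx e mulpK ?prod_qfact_neq0.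
Qed.

Lemma polyOver_qmultinomial N (k : seq nat) :
  qmultinomial F N k \is a polyOver Num.nat_num_subdef.
Proof.
rewrite /qmultinomial; case: eqP => [<-|_]; last exact: rpred0.
by have [c cN ->] := qfact_sumn k; rewrite mulpK ?prod_qfact_neq0.
Qed.

Lemma finite_qmultinomial r N :
  finite_set [set k : r.-tuple nat | qmultinomial F N k != 0].
Proof.
apply: (@sub_finite_set _ _
  ((fun t : r.-tuple 'I_N.+1 => [tuple of map val t]) @` setT)); last first.
  exact/finite_image/finite_finset.
move=> k /=; rewrite /qmultinomial; have [sumk _|_] := eqVneq (sumn k) N; last by rewrite eqxx.
exists [tuple of map inord k] => //; apply/val_inj => /=.
rewrite -map_comp -[RHS]map_id; apply/eq_in_map => j jk /=.
by rewrite inordK// ltnS -sumk sumnE (big_rem j)//= leq_addr.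
Qed.

Lemma polyOver_galois_number r N :
  galois_number F r N \is a polyOver Num.nat.
Proof.
suff: galois_number F r N \is a polyOver Num.nat_num_subdef by [].
apply: rpred_sum => k _.
exact: polyOver_qmultinomial.
Qed.

End Exactness.

(* Main.v *)
Require Import Defs.
From HB Require Import structures.
From mathcomp Require Import all_boot all_order all_algebra all_fingroup.
From mathcomp Require Import all_classical all_reals all_analysis.
From mathcomp Require Import zify.
Set Implicit Arguments.
Unset Strict Implicit.
Unset Printing Implicit Defensive.
Import Order.TTheory GRing.Theory Num.Theory.
Import numFieldNormedType.Exports.
Local Open Scope classical_set_scope.
Local Open Scope ring_scope.

(** Both sides of the first identity count words.  A word is a function [f]
    from the positions ['I_N] to the letters ['I_r], weighted by ['X] to the
    power of its number of inversions.

    Sorting words by content, i.e. by the multiplicities [k] of the letters,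
    gives q-multinomial coefficients ([macmahon], [qmultinomial_words]): when
    the first letter [x] is removed from a word of content [k], the inversions
    lost are the letters smaller than [x], and
    [[k_0 + ... + k_(r-1)] = \sum_x q^(k_0 + ... + k_(x-1)) [k_x]] for the
    q-numbers [[n] = 1 + q + ... + q^(n-1)].  Hence the Galois number is the
    inversion enumerator of all words ([galois_number_words]).

    Sorting words by standardization gives permutations: number the positions
    in increasing order of their letters, equal letters from left to right.
    This preserves the inversions ([inversions_standardization]).  A word with
    standardization [s^-1] is a weakly increasing sequence
    [f (s 0) <= f (s 1) <= ...] that is strict at the descents of [s]; adding to
    its [i]-th term the number of ascents of [s] before [i] makes it strictly
    increasing, with no other constraint than its range, so there are
    ['C(N + r - 1 - des s, N)] of them ([card_standardization]).  Since inverting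
    a permutation preserves the inversions, the first identity follows.

    The limit holds term by term, because [N! 'C(N + r - 1 - d, N)] is a product
    of [N] factors, each equivalent to [r] as [r] grows.  The last identity is
    the case of words with content [(1, ..., 1)], which are the permutations. *)

(** * Words, their inversions and their contents *)

Section Words.
Variable r : nat.

(** For a permutation [s], [word_inv s] is convertible to [inversions s]. *)
Definition word_inv N (f : 'I_N -> 'I_r) : nat :=
  #|[set p : 'I_N * 'I_N | (p.1 < p.2)%N && (f p.2 < f p.1)%N]%SET|.

Lemma eq_word_inv N (f g : 'I_N -> 'I_r) : f =1 g -> word_inv f = word_inv g.
Proof. by move=> fg; apply: eq_card => p; rewrite !inE !fg. Qed.

Lemma word_invE N (f : 'I_N -> 'I_r) :
  word_inv f = (\sum_(i < N) \sum_(j < N | (i < j) && (f j < f i)) 1)%N.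
Proof. by rewrite /word_inv -sum1dep_card pair_big_dep. Qed.

Definition word_cons N (x : 'I_r) (f : 'I_N -> 'I_r) (i : 'I_N.+1) : 'I_r :=
  if unlift ord0 i is Some j then f j else x.

Lemma word_cons0 N x (f : 'I_N -> 'I_r) : word_cons x f ord0 = x.
Proof. by rewrite /word_cons unlift_none. Qed.

Lemma word_consS N x (f : 'I_N -> 'I_r) j : word_cons x f (lift ord0 j) = f j.
Proof. by rewrite /word_cons liftK. Qed.

(** The first letter forms an inversion with each smaller letter after it. *)
Lemma word_inv_cons N x (f : 'I_N -> 'I_r) :
  word_inv (word_cons x f) = (#|[pred j | (f j < x)%N]| + word_inv f)%N.
Proof.
rewrite !word_invE big_ord_recl; congr addn.
  rewrite big_mkcond big_ord_recl /= add0n -big_mkcond /= -sum1_card.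
  by apply: eq_big => // j; rewrite word_cons0 word_consS.
apply: eq_bigr => i _; rewrite big_mkcond big_ord_recl /= add0n -big_mkcond /=.
by apply: eq_big => // j; rewrite !word_consS /bump /= !add1n ltnS.
Qed.

Definition content N (f : 'I_N -> 'I_r) : r.-tuple nat :=
  [tuple #|[pred i | f i == x]| | x < r].

Lemma eq_content N (f g : 'I_N -> 'I_r) : f =1 g -> content f = content g.
Proof.
by move=> fg; apply/eq_from_tnth => x; rewrite !tnth_mktuple; apply: eq_card => i;
  rewrite !inE fg.
Qed.

Lemma nth_content N (f : 'I_N -> 'I_r) (x : 'I_r) :
  nth 0%N (content f) x = #|[pred i | f i == x]|.
Proof. by rewrite -tnth_nth tnth_mktuple. Qed.

Lemma sumn_tuple (k : r.-tuple nat) : sumn k = (\sum_(x < r) nth 0 k x)%N.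
Proof. by rewrite sumnE big_tuple; apply: eq_bigr => x _; rewrite (tnth_nth 0%N). Qed.

Lemma content_cons N x (f : 'I_N -> 'I_r) (y : 'I_r) :
  nth 0%N (content (word_cons x f)) y = (nth 0 (content f) y + (x == y))%N.
Proof.
rewrite addnC !nth_content -!sum1_card big_mkcond big_ord_recl /= inE word_cons0.
rewrite -big_mkcond /=; congr addn.
by apply: eq_bigl => j; rewrite !inE word_consS.
Qed.

(** With [word_inv_cons], this makes the number of inversions lost with the first
    letter depend on the content only. *)
Lemma card_lt_content N (f : 'I_N -> 'I_r) (x : 'I_r) :
  #|[pred j | (f j < x)%N]| = (\sum_(y < x) nth 0 (content f) y)%N.
Proof.
rewrite (big_ord_widen r) 1?ltnW// -sum1_card.
rewrite (partition_big f (fun y : 'I_r => (y < x)%N))//=.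
apply: eq_bigr => y yx; rewrite nth_content -sum1_card; apply: eq_bigl => j.
by rewrite !inE; case: eqP => [->|]; rewrite ?yx ?andbF.
Qed.

End Words.

Lemma sum_word_cons (V : nmodType) r N (F : {ffun 'I_N.+1 -> 'I_r} -> V) :
  \sum_f F f = \sum_(x < r) \sum_(f : {ffun 'I_N -> 'I_r}) F (finfun (word_cons x f)).
Proof.
rewrite pair_bigA /=.
rewrite (reindex (fun p : 'I_r * {ffun 'I_N -> 'I_r} => finfun (word_cons p.1 p.2)))//=.
exists (fun f : {ffun 'I_N.+1 -> 'I_r} => (f ord0, [ffun j => f (lift ord0 j)])).
  move=> [x f] _ /=; rewrite ffunE word_cons0; congr pair.
  by apply/ffunP => j; rewrite !ffunE word_consS.
move=> f _ /=; apply/ffunP => i; rewrite ffunE.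
by case: (unliftP ord0 i) => [j|] ->; rewrite ?word_consS ?word_cons0 ?ffunE.
Qed.

(** * Words of given content and q-multinomial coefficients *)

Section MacMahon.
Variable F : archiRealFieldType.
Local Notation qnum n := (\sum_(i < n) 'X^i : {poly F}).

Lemma qnumD a b : qnum (a + b) = qnum a + 'X^a * qnum b.
Proof.
rewrite big_split_ord/= mulr_sumr; congr (_ + _).
by apply: eq_bigr => i _; rewrite exprD.
Qed.

(** An interval of length [\sum_x k x] is cut into consecutive intervals of lengths
    [k x]; the [x]-th starts at [\sum_(y < x) k y]. *)
Lemma qnum_sum (k : nat -> nat) r :
  \sum_(x < r) 'X^(\sum_(y < x) k y) * qnum (k x) = qnum (\sum_(x < r) k x).
Proof.
elim: r => [|r IHr]; first by rewrite !big_ord0.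
by rewrite !big_ord_recr /= IHr qnumD.
Qed.

(** MacMahon's theorem, in a form without division.  Removing the first letter [x]
    lowers the [x]-th part of [k] by one, which trades the factor [qfact (k x)] for
    [qfact (k x).-1] and the q-number of [k x]; the powers of ['X] given by
    [word_inv_cons] and these q-numbers add up to the q-number of [N] by
    [qnum_sum]. *)
Lemma macmahon r N (k : r.-tuple nat) : sumn k = N ->
  (\sum_(f : {ffun 'I_N -> 'I_r} | content f == k) 'X^(word_inv f)) *
    \prod_(j <- k) qfact F j = qfact F N.
Proof.
elim: N k => [|N IHN] k sumk.
  have k0 (x : 'I_r) : nth 0%N k x = 0%N.
    by move/eqP: sumk; rewrite sumn_tuple sum_nat_eq0 => /forallP/(_ x)/eqP.
  have -> : \prod_(j <- k) qfact F j = 1.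
    by rewrite big_tuple big1// => x _; rewrite (tnth_nth 0%N) k0 qfact0.
  rewrite mulr1.
  have f0 (f : 'I_0 -> 'I_r) : content f == k.
    apply/eqP/eq_from_tnth => x; rewrite !(tnth_nth 0%N) nth_content k0.
    by apply: eq_card0 => -[].
  under eq_bigl do rewrite f0.
  rewrite (eq_bigr (fun=> 1)) => [|f _].
    by rewrite sumr_const card_ffun !card_ord expn0 qfact0.
  by rewrite word_invE big_ord0.
rewrite big_mkcond sum_word_cons mulr_suml qfactS.
have -> : qnum N.+1 = \sum_(x < r) 'X^(\sum_(y < x) nth 0%N k y) * qnum (nth 0%N k x).
  by rewrite -sumk sumn_tuple qnum_sum.
rewrite mulr_sumr; apply: eq_bigr => x _.
pose pos := [tuple (tnth k y - (x == y))%N | y < r].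
(* If [x] does not occur in [k], no word of content [k] starts with [x], and the
   q-number on the right is zero. *)
have [kx0|kx_gt0] := posnP (nth 0%N k x).
  rewrite kx0 big_ord0 !mulr0 big1 ?mul0r// => f _; case: ifP => // /eqP contk.
  have := content_cons x f x; rewrite eqxx addn1.
  by rewrite -(eq_content (ffunE _)) contk kx0.
have nth_pos (y : 'I_r) : nth 0%N k y = (nth 0 pos y + (x == y))%N.
  rewrite -(tnth_nth 0%N pos) tnth_mktuple (tnth_nth 0%N).
  by case: eqP => [<-|]; rewrite /= ?subn0 ?addn0// subnK.
have sumpos : sumn pos = N.
  apply/eqP; rewrite -(eqn_add2r 1) !addn1 -sumk !sumn_tuple.
  under [X in _ == X]eq_bigr do rewrite nth_pos.
  rewrite big_split /= -addn1 eqn_add2l eq_sym (bigD1 x)//= eqxx big1// => y.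
  by rewrite eq_sym => /negPf ->.
have contE (f : {ffun 'I_N -> 'I_r}) :
    (content (finfun (word_cons x f)) == k) = (content f == pos).
  rewrite (eq_content (ffunE _)).
  apply/eqP/eqP => [contk|contp]; apply/eq_from_tnth => y; rewrite !(tnth_nth 0%N).
    by apply/eqP; rewrite -(eqn_add2r (x == y)) -nth_pos -contk content_cons.
  by rewrite nth_pos -contp content_cons.
rewrite -big_mkcond /= (eq_bigl _ _ contE).
rewrite (eq_bigr (fun f : {ffun 'I_N -> 'I_r} =>
    'X^(\sum_(y < x) nth 0%N k y) * 'X^(word_inv f))) => [|f /eqP contp].
  rewrite -mulr_sumr.
  have -> : \prod_(j <- k) qfact F j =
      qnum (nth 0%N k x) * \prod_(j <- pos) qfact F j.
    rewrite !big_tuple (bigD1 x)//= [in RHS](bigD1 x)//= mulrA; congr (_ * _).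
      rewrite !(tnth_nth 0%N) nth_pos eqxx addn1 qfactS mulrC; done.
    apply: eq_bigr => y yx; rewrite !(tnth_nth 0%N) nth_pos.
    by rewrite eq_sym (negPf yx) addn0.
  by rewrite -(IHN _ sumpos) mulrACA mulrC.
rewrite -exprD (eq_word_inv (ffunE (word_cons x f))) word_inv_cons card_lt_content.
congr ('X^(_ + _)); apply: eq_bigr => y _.
have yr : (y < r)%N by apply: ltn_trans (ltn_ord y) _.
by rewrite contp (nth_pos (Ordinal yr)) -val_eqE /= gtn_eqF ?addn0.
Qed.

Lemma sumn_content r N (f : 'I_N -> 'I_r) : sumn (content f) = N.
Proof.
rewrite sumn_tuple -[RHS]card_ord -sum1_card (partition_big f xpredT)//=.
by apply: eq_bigr => x _; rewrite nth_content -sum1_card.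
Qed.

Lemma qmultinomial_words r N (k : r.-tuple nat) :
  qmultinomial F N k =
  \sum_(f : {ffun 'I_N -> 'I_r} | content f == k) 'X^(word_inv f).
Proof.
have [sumk|sumkN] := eqVneq (sumn k) N.
  apply: (mulIf (prod_qfact_neq0 F k)).
  by rewrite macmahon// -sumk qmultinomialK.
rewrite /qmultinomial (negPf sumkN) big1// => f /eqP contk.
by move: sumkN; rewrite -contk sumn_content eqxx.
Qed.

Lemma galois_number_words r N :
  galois_number F r N = \sum_(f : {ffun 'I_N -> 'I_r}) 'X^(word_inv f).
Proof.
(* A q-multinomial coefficient vanishes unless its index is the content of a
   word, so the sum over all tuples reduces to the finite list of contents. *)
pose ks := undup [seq content f | f : {ffun 'I_N -> 'I_r}].
have mem_ks (f : {ffun 'I_N -> 'I_r}) : content f \in ks.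
  by rewrite mem_undup (codom_f (fun f : {ffun _ -> _} => content f)).
rewrite /galois_number (fsbigE ks)//= ?undup_uniq// => [|k _ kks]; last first.
  rewrite qmultinomial_words big1// => f /eqP contk.
  by rewrite -contk mem_ks in kks.
under eq_bigl do rewrite in_setT.
under eq_bigr do rewrite qmultinomial_words big_mkcond.
rewrite exchange_big /=; apply: eq_bigr => f _.
rewrite (bigD1_seq (content f))//= ?undup_uniq// eqxx big1 ?addr0// => k kf.
by rewrite eq_sym (negPf kf).
Qed.

(** Permutations are the words on [N] letters in which each letter occurs once,
    and the product of q-factorials in [macmahon] is then 1. *)
Lemma sum_inversions_qfact N :
  \sum_(s : 'S_N) 'X^(inversions s) = qfact F N.
Proof.
pose k := [tuple 1%N | x < N].
have sumk : sumn k = N.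
  by rewrite sumn_tuple (eq_bigr (fun=> 1%N)) ?sum1_card ?card_ord// => x _;
     rewrite -tnth_nth tnth_mktuple.
rewrite -(macmahon sumk).
have -> : \prod_(j <- k) qfact F j = 1.
  by rewrite big_tuple big1// => x _; rewrite tnth_mktuple qfactS qfact0 mul1r big_ord1.
rewrite mulr1.
rewrite (reindex (fun s : 'S_N => finfun s)) /=; last first.
  exists (insubd (1%g : 'S_N)) => [s _|f /eqP contk].
    have -> : finfun s = pval s by apply/ffunP => x; rewrite ffunE -pvalE.
    exact: valKd.
  have injf : injectiveb f.
    apply/injectiveP => x y fxy.
    have : (#|[pred i | f i == f x]| <= 1)%N.
      by rewrite -nth_content contk -tnth_nth tnth_mktuple.
    by move/card_le1_eqP => k1; apply: k1; rewrite !inE ?fxy.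
  by apply/ffunP => x; rewrite ffunE -pvalE insubdK.
apply: eq_big => [s|s _]; last by congr 'X^_; apply: eq_word_inv => i; rewrite ffunE.
apply/esym/eqP/eq_from_tnth => x; rewrite !tnth_mktuple.
by rewrite -(card1 (s^-1%g x)); apply: eq_card => i; rewrite !inE ffunE (canF_eq (permK s)).
Qed.
End MacMahon.

(** * Standardization of words *)

Section Standardization.
Variables (r N : nat).
Implicit Types (f : 'I_N -> 'I_r) (s : 'S_N).

(** The strict total order on positions that a stable sort of the letters
    produces. *)
Definition stable_lt f (x y : 'I_N) : bool :=
  (f x < f y)%N || (f x == f y :> nat) && (x < y)%N.

Definition standardizes s f := forall x y, (s x < s y)%N = stable_lt f x y.

Lemma card_perm_lt s x : #|[pred y | (s y < s x)%N]| = s x.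
Proof.
transitivity (\sum_(y < s x) 1)%N; last by rewrite sum1_card card_ord.
rewrite (big_ord_widen N (fun=> 1%N)) 1?ltnW// -sum1_card.
by rewrite [RHS](reindex_inj (@perm_inj _ s)); apply: eq_bigl => y; rewrite !inE.
Qed.

Lemma stable_rank_subproof f x : (#|[pred y | stable_lt f y x]| < N)%N.
Proof.
rewrite -[ltnRHS]card_ord; apply: proper_card; apply/properP; split.
  by apply/fintype.subsetP => y.
by exists x; rewrite // !inE /stable_lt !ltnn andbF.
Qed.

Definition stable_rank f x : 'I_N := Ordinal (stable_rank_subproof f x).

Lemma stable_rank_lt f x y :
  stable_lt f x y -> (stable_rank f x < stable_rank f y)%N.
Proof.
move=> xy; apply: proper_card; apply/properP; split.
  by apply/fintype.subsetP => z; rewrite !inE /stable_lt in xy *; lia.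
by exists x; rewrite !inE // /stable_lt !ltnn andbF.
Qed.

Lemma stable_rank_inj f : injective (stable_rank f).
Proof.
move=> x y xy; apply/eqP; apply: contraT => neq_xy.
have [/stable_rank_lt|/stable_rank_lt] : stable_lt f x y \/ stable_lt f y x.
- move: neq_xy; rewrite -(inj_eq val_inj) /stable_lt /=; lia.
- by rewrite xy ltnn.
- by rewrite xy ltnn.
Qed.

(** Here a permutation sends a position to its rank, so it is the inverse of the
    permutation that lists the positions in sorted order. *)
Definition standardization f : 'S_N := perm (@stable_rank_inj f).

Lemma standardizationP f : standardizes (standardization f) f.
Proof.
move=> x y; rewrite !permE; apply/idP/idP => [xy|]; last exact: stable_rank_lt.
apply: contraLR xy => nxy; rewrite -leqNgt.
have [->//|neq_xy] := eqVneq x y.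
apply/ltnW/stable_rank_lt; move: neq_xy nxy.
by rewrite -(inj_eq val_inj) /stable_lt /=; lia.
Qed.

(** A permutation is determined by the order of its values, since each value is
    the number of smaller ones ([card_perm_lt]). *)
Lemma standardization_eqP s f : reflect (standardizes s f) (standardization f == s).
Proof.
apply: (iffP eqP) => [<-|sf]; first exact: standardizationP.
apply/permP => x; apply/val_inj.
rewrite /= -[LHS]card_perm_lt -[RHS]card_perm_lt.
by apply: eq_card => y; rewrite !inE sf standardizationP.
Qed.

(** For [x < y], position [y] precedes [x] in the stable order exactly when its
    letter is smaller: a tie would be won by [x]. *)
Lemma inversions_standardization f : inversions (standardization f) = word_inv f.
Proof.
apply: eq_card => p; rewrite !inE standardizationP /stable_lt.
case: ltnP => //= p12; lia.
Qed.

(** A pair [(i, j)] is an inversion of [s] exactly when [(s j, s i)] is one of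
    [s^-1]. *)
Lemma inversionsV s : inversions (s^-1)%g = inversions s.
Proof.
pose h (p : 'I_N * 'I_N) := ((s^-1)%g p.2, (s^-1)%g p.1).
have h_inj : injective h by move=> [a b] [c d] [] /perm_inj -> /perm_inj ->.
rewrite /inversions -(card_imset _ h_inj); apply: eq_card => -[x y].
apply/imsetP/idP => [[[a b]]|].
  by rewrite inE /= => /andP[ab ba] [-> ->]; rewrite inE /= !permKV ab ba.
rewrite inE /= => /andP[xy yx]; exists (s y, s x); last by rewrite /h /= !permK.
by rewrite inE /= !permK xy yx.
Qed.

(** The values of [s] list the positions in sorted order as soon as consecutive
    ones are in order; the boolean summand makes the comparison strict when [s]
    decreases, that is when the tie would be won by [s j]. *)
Lemma standardizesVP s f : standardizes (s^-1)%g f <->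
  (forall i j : 'I_N, j = i.+1 :> nat -> (f (s i) + (s j < s i) <= f (s j))%N).
Proof.
split=> [sf i j ji|adj x y].
  have := sf (s i) (s j); rewrite !permK ji ltnSn /stable_lt; lia.
have chain d (i j : 'I_N) : j = (i + d.+1)%N :> nat -> stable_lt f (s i) (s j).
  elim: d j => [|d IHd] j; rewrite ?addn1 => ji.
    have : s i != s j by rewrite (inj_eq perm_inj) -val_eqE /= ji ltn_eqF.
    have := adj i j ji; rewrite -val_eqE /= /stable_lt; lia.
  have jN : (i + d.+1 < N)%N by have := ltn_ord j; lia.
  have e : j = (Ordinal jN).+1 :> nat by rewrite ji addnS.
  have := IHd (Ordinal jN) erefl; have := adj _ _ e; rewrite /stable_lt.
  have : s (Ordinal jN) != s j.
    by rewrite (inj_eq perm_inj) -val_eqE /= e ltn_eqF.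
  rewrite -val_eqE /=; lia.
have lt_chain (i j : 'I_N) : (i < j)%N -> stable_lt f (s i) (s j).
  by move=> ij; apply: (chain (j - i.+1)%N); lia.
have := lt_chain ((s^-1)%g x) ((s^-1)%g y).
have := lt_chain ((s^-1)%g y) ((s^-1)%g x).
rewrite !permKV; have [->|neq_xy] := eqVneq x y; first by rewrite /stable_lt !ltnn andbF.
have : (s^-1)%g x != (s^-1)%g y by rewrite (inj_eq perm_inj).
by rewrite -val_eqE /= /stable_lt; lia.
Qed.

End Standardization.


(** * The number of words with a given standardization *)

Section Counting.
Variables (n r : nat) (s : 'S_n.+1).

(** Indices are natural numbers, so that sums and inductions need no bound
    proofs; the value is meaningful for [k < n] only. *)
Definition descent (k : nat) : bool := (s (inord k.+1) < s (inord k))%N.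

Definition ascents_before (m : nat) : nat := (\sum_(k < m) ~~ descent k)%N.

Lemma ascents_beforeS m : ascents_before m.+1 = (ascents_before m + ~~ descent m)%N.
Proof. exact: big_ord_recr. Qed.

(** The last position has no successor, hence is not a descent: the sum stops at
    [n] although [s] permutes [n.+1] points. *)
Lemma des_sum : des s = (\sum_(k < n) descent k)%N.
Proof.
rewrite /des /descent_set -sum1dep_card big_mkcond big_ord_recr /=.
rewrite [X in (_ + X)%N]ifN ?addn0 => [|]; last first.
  by apply/existsP => -[j /andP[/eqP jn _]]; have := ltn_ord j; rewrite jn ltnn.
apply: eq_bigr => i _; rewrite /descent.
have -> : inord i = widen_ord (leqnSn n) i by apply/val_inj; rewrite /= inordK// ltnS ltnW.
have ei : (inord i.+1 : 'I_n.+1) = i.+1 :> nat by rewrite inordK// ltnS.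
suff -> : [exists j : 'I_n.+1, (j == i.+1 :> nat) && (s j < s (widen_ord (leqnSn n) i))%N]
    = (s (inord i.+1) < s (widen_ord (leqnSn n) i))%N by case: (_ < _)%N.
apply/existsP/idP => [[j /andP[/eqP ji]]|lt_s]; last by exists (inord i.+1); rewrite ei eqxx.
by rewrite (_ : j = inord i.+1)//; apply/val_inj; rewrite /= ei.
Qed.

(** This equation turns the largest value [r + ascents_before n] of a spread-out
    sequence into the range of the count in [card_standardization]. *)
Lemma ascents_before_last : (ascents_before n + des s = n)%N.
Proof.
rewrite des_sum -big_split /= -[RHS]card_ord -sum1_card.
by apply: eq_bigr => k _; case: (descent k).
Qed.

Lemma ascents_before_le i j : (i <= j)%N ->
  (ascents_before j <= ascents_before i + (j - i))%N.
Proof.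
elim: j => [|j IHj]; first by rewrite leqn0 => /eqP ->; rewrite subnn addn0.
rewrite leq_eqVlt => /predU1P[<-|ij]; first by rewrite subnn addn0.
by have := IHj ij; rewrite ascents_beforeS; lia.
Qed.

Lemma increasing_gap (b : nat -> nat) m : (forall k, (k < m)%N -> (b k < b k.+1)%N) ->
  forall i j, (i <= j <= m)%N -> (b i + (j - i) <= b j)%N.
Proof.
move=> bS i; elim=> [|j IHj]; first by rewrite leqn0 => /andP[/eqP -> _]; rewrite subnn addn0.
move=> /andP[]; rewrite leq_eqVlt => /predU1P[<- _|ij jm]; first by rewrite subnn addn0.
by have := bS j jm; have := IHj; lia.
Qed.

Lemma standardizesVP_nat (f : 'I_n.+1 -> 'I_r.+1) : standardizes (s^-1)%g f <->
  forall k, (k < n)%N ->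
    (f (s (inord k)) + descent k <= f (s (inord k.+1)))%N.
Proof.
rewrite standardizesVP; split=> [adj k kn|adj i j ji].
  by apply: adj; rewrite !inordK// ltnS// ltnW.
have := adj i; rewrite /descent -ji !inord_val; apply.
by have := ltn_ord j; rewrite ji.
Qed.

Local Notation M := (n + r - des s)%N.

(** The condition [a i + descent i <= a i.+1] on the sequence [a i = f (s i)]
    becomes [b i < b i.+1] for [b i = a i + ascents_before i], because
    [ascents_before] grows by [~~ descent i].  So [f] corresponds to a strictly
    increasing sequence of length [n.+1] bounded by [r + ascents_before n]. *)
Lemma card_standardization :
  #|[pred f : {ffun 'I_n.+1 -> 'I_r.+1} | standardization f == (s^-1)%g]| =
  'C(M.+1, n.+1).
Proof.
rewrite -card_ltn_sorted_tuples.
have An := ascents_before_last.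
pose spread (f : {ffun 'I_n.+1 -> 'I_r.+1}) : n.+1.-tuple 'I_M.+1 :=
  [tuple inord (f (s i) + ascents_before i) | i < n.+1].
pose A := [set f : {ffun 'I_n.+1 -> 'I_r.+1} | standardization f == (s^-1)%g]%SET.
have mono (f : {ffun 'I_n.+1 -> 'I_r.+1}) : f \in A -> forall i j, (i <= j <= n)%N ->
    (f (s (inord i)) + ascents_before i + (j - i) <= f (s (inord j)) + ascents_before j)%N.
  rewrite inE => /standardization_eqP /standardizesVP_nat adj.
  apply: (increasing_gap (b := fun k => (f (s (inord k)) + ascents_before k)%N)) => k kn.
  by have := adj k kn; rewrite ascents_beforeS; case: (descent k); lia.
have spreadE (f : {ffun 'I_n.+1 -> 'I_r.+1}) i : f \in A ->
    tnth (spread f) i = (f (s i) + ascents_before i)%N :> nat.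
  move=> fA; rewrite tnth_mktuple inordK// ltnS.
  have := mono f fA i n; rewrite -ltnS ltn_ord leqnn inord_val => /(_ isT).
  by have := ltn_ord (f (s (inord n))); have := ltn_ord i; lia.
have spread_inj : {in A &, injective spread}.
  move=> f g fA gA fg; apply/ffunP => x; apply/val_inj/eqP.
  rewrite -(permKV s x) -(eqn_add2r (ascents_before ((s^-1)%g x))).
  by rewrite -!spreadE// fg.
rewrite -[LHS](_ : #|A| = _); last by apply: eq_card => f; rewrite !inE.
rewrite -(card_in_imset spread_inj); apply: eq_card => t; rewrite inE.
have nth_t (u : n.+1.-tuple 'I_M.+1) k : (k < n.+1)%N ->
    nth 0%N [seq \val i | i <- u] k = tnth u (inord k).
  by move=> kn; rewrite (nth_map ord0) ?size_tuple// (tnth_nth ord0) inordK.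
apply/imsetP/idP => [[f fA ->]|/(sortedP 0%N)].
  apply/(sortedP 0%N) => k; rewrite size_map size_tuple => kn.
  rewrite !nth_t ?spreadE// ?inordK//; try lia.
  have := mono f fA k k.+1; rewrite leqnSn -ltnS kn => /(_ isT).
  rewrite subSn// subnn addn1. exact.
rewrite size_map size_tuple => t_lt.
have gap : forall i j, (i <= j <= n)%N ->
    (tnth t (inord i) + (j - i) <= tnth t (inord j))%N.
  apply: (increasing_gap (b := fun k => tnth t (inord k))) => k kn.
  by rewrite -!nth_t; [apply: t_lt| |]; lia.
(* The inverse of [spread]; the bounds [asc_le] and [squeezeE] show that neither
   the subtraction nor [inord] truncates. *)
pose squeeze := [ffun x : 'I_n.+1 =>
  inord (tnth t ((s^-1)%g x) - ascents_before ((s^-1)%g x)) : 'I_r.+1].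
have asc_le (i : 'I_n.+1) : (ascents_before i <= tnth t i)%N.
  have := gap 0%N i; rewrite inord_val leq0n -ltnS ltn_ord => /(_ isT).
  have := ascents_before_le (leq0n i); rewrite {2}/ascents_before big_ord0; lia.
have squeezeE (i : 'I_n.+1) : squeeze (s i) = (tnth t i - ascents_before i)%N :> nat.
  rewrite ffunE permK inordK// ltnS.
  have := gap i n; rewrite inord_val -ltnS ltn_ord leqnn => /(_ isT).
  have := ascents_before_le (ltn_ord i : (i <= n)%N).
  by have := ltn_ord (tnth t (inord n)); have := ltn_ord i; lia.
have sqA : squeeze \in A.
  rewrite inE; apply/standardization_eqP/standardizesVP_nat => k kn.
  rewrite !squeezeE !inordK//; last lia.
  have := gap k k.+1; have := asc_le (inord k); have := asc_le (inord k.+1).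
  rewrite !inordK//; try lia.
  by rewrite ascents_beforeS; case: (descent k); lia.
exists squeeze => //; apply/eq_from_tnth => i; apply/val_inj.
by rewrite /= spreadE// squeezeE subnK.
Qed.

End Counting.

(** * The Galois number as a sum over permutations *)

Section GaloisPermutations.
Variable F : archiRealFieldType.

(** The term of [s] collects the words with standardization [s^-1], because
    [card_standardization] counts the words with standardization [t] by the
    descents of [t^-1]; [inversionsV] makes this exchange harmless. *)
Lemma galois_number_perms r N :
  galois_number F r.+1 N =
    \sum_(s : 'S_N) 'C(N + r.+1 - 1 - des s, N)%:R *: 'X^(inversions s).
Proof.
rewrite galois_number_words.
transitivity (\sum_(s : 'S_N)
    #|[pred f : {ffun 'I_N -> 'I_r.+1} | standardization f == (s^-1)%g]|%:R *:
      'X^(inversions s) : {poly F}).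
  rewrite (partition_big (fun f : {ffun 'I_N -> 'I_r.+1} => standardization f) xpredT)//=.
  rewrite (reindex_inj (@invg_inj _)); apply: eq_bigr => s _.
  rewrite (eq_bigr (fun=> 'X^(inversions s))) => [|f /eqP std_f].
    by rewrite sumr_const scaler_nat; congr (_ *+ _); apply: eq_card => f; rewrite !inE.
  by rewrite -inversions_standardization std_f inversionsV.
apply: eq_bigr => s _; congr (_%:R *: _).
case: N s => [|n] s; last first.
  rewrite card_standardization; congr 'C(_, _).
  by have := ascents_before_last s; lia.
rewrite bin0 -[RHS](_ : #|{: {ffun 'I_0 -> 'I_r.+1}}| = 1%N); last first.
  by rewrite card_ffun !card_ord expn0.
by apply: eq_card => f; rewrite !inE; apply/eqP/permP => -[].
Qed.

End GaloisPermutations.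

(** * Growth of the binomial coefficients *)

Section Asymptotics.
Variable R : realType.

Lemma cvg_invn : (r%:R^-1 : R) @[r --> \oo] --> (0 : R).
Proof. by rewrite -cvg_shiftS; exact: cvg_harmonic. Qed.

Lemma cvg_shifted_ratio (a b : nat) : (a + r - b)%:R / r%:R @[r --> \oo] --> (1 : R).
Proof.
have: 1 + (a%:R - b%:R) * r%:R^-1 @[r --> \oo] --> (1 + (a%:R - b%:R) * 0 : R).
  by apply: cvgD; [exact: cvg_cst|apply: cvgMr; exact: cvg_invn].
rewrite mulr0 addr0; apply: cvg_trans; apply: near_eq_cvg.
near=> r.
have r_gt0 : (0 < r)%N by near: r; exact: nbhs_infty_gt.
have br : (b <= r)%N by near: r; exact: nbhs_infty_ge.
rewrite natrB ?natrD; last by rewrite (leq_trans br)// leq_addl.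
by rewrite [in RHS]addrAC [RHS]mulrDl divff ?pnatr_eq0 -?lt0n// [RHS]addrC.
Unshelve. all: by end_near. Qed.

(** The numerator [N! 'C(m, N)] is the falling factorial of [m], a product of [N]
    factors that are each [r] up to a constant. *)
Lemma cvg_bin_ratio (N d : nat) :
  N`!%:R / r%:R ^+ N * 'C(N + r - 1 - d, N)%:R @[r --> \oo] --> (1 : R).
Proof.
have: \prod_(j < N) ((N + r - (1 + d + j))%:R / r%:R) @[r --> \oo] -->
    (\prod_(j < N) 1 : R).
  by apply: cvg_big => [|j _]; [exact: mul_continuous|exact: cvg_shifted_ratio].
rewrite big1_eq; apply: cvg_trans; apply: near_eq_cvg; near=> r.
rewrite mulrAC -natrM mulnC bin_ffact ffact_prod big_split /= prodfV.
rewrite prodr_const card_ord natr_prod; congr (_ / _).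
by apply: eq_bigr => j _; rewrite !subnDA.
Unshelve. all: by end_near. Qed.

End Asymptotics.

Theorem theorem4p1 (R : realType) (N : nat) :
  (forall r : nat, (2 <= r)%N ->
     galois_number R r N =
       \sum_(s : 'S_N) 'C(N + r - 1 - des s, N)%:R *: 'X^(inversions s))
  /\ (forall i : nat,
       ((N`!%:R / r%:R ^+ N) *: galois_number R r N)`_i @[r --> \oo]
         --> (\sum_(s : 'S_N) 'X^(inversions s) : {poly R})`_i)
  /\ \sum_(s : 'S_N) 'X^(inversions s) = qfact R N.
Proof.
split; first by case=> // r _; exact: galois_number_perms.
split; last exact: sum_inversions_qfact.
move=> i; rewrite coef_sum.
have: \sum_(s : 'S_N) (N`!%:R / r%:R ^+ N * 'C(N + r - 1 - des s, N)%:R) *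
      ('X^(inversions s) : {poly R})`_i @[r --> \oo] -->
    \sum_(s : 'S_N) 1 * ('X^(inversions s) : {poly R})`_i.
  by apply: cvg_big => [|s _]; [exact: add_continuous|apply: cvgMl; exact: cvg_bin_ratio].
under [X in _ --> X]eq_bigr do rewrite mul1r.
apply: cvg_trans; apply: near_eq_cvg; near=> r.
have : (0 < r)%N by near: r; exact: nbhs_infty_gt.
move=> /prednK <-; rewrite galois_number_perms coefZ coef_sum mulr_sumr.
by apply: eq_bigr => s _; rewrite coefZ mulrA.
Unshelve. all: by end_near. Qed.
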